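(* ($S$-Prime Element Principle.) Let $L$ be a $V$-lattice whose greatest element $1$ is compact, and let $S$ be a multiplicatively closed subset of $L$ (with $1\in S$, $0\notin S$). Let $\mathscr{F}\subseteq L$ be an $S$-Ako family or an $S$-Oka family in $L$, let $\mathscr{F}'=L\setminus\mathscr{F}$, and let $\mathrm{Max}(\mathscr{F}')$ be the set of maximal elements of $\mathscr{F}'$. Suppose that for every $m\in \mathrm{Max}(\mathscr{F}')$ one has $t\nleq m$ for all $t\in S$. Then $\mathrm{Max}(\mathscr{F}')\subseteq \mathrm{Spec}_S(L)$, i.e. every maximal element of $\mathscr{F}'$ is an $S$-prime element of $L$.
   Context: A $V$-lattice is a complete lattice $L$ (least element $0$, greatest element $1$) with a commutative, associative binary operation $\cdot$ such that for all $a,b,c\in L$: $a\le b$ implies $a\cdot c\le b\cdot c$; $a\cdot b\le a\wedge b$; and $a\cdot 1=a$. (Multiplication need not distribute over joins.) An element $c\in L$ is compact if $c\le\bigvee_{\alpha\in\Lambda}a_\alpha$ implies $c\le\bigvee_{\alpha\in\Lambda_0}a_\alpha$ for some finite $\Lambda_0\subseteq\Lambda$; $L_*$ is the set of compact elements. A multiplicatively closed subset is a nonempty $S\subseteq L_*$ with $s_1\cdot s_2\in S$ for all $s_1,s_2\in S$; throughout, $1\in S$ and $0\notin S$. For $a,b\in L$, $(a:b)=\bigvee\{x\in L: x\cdot b\le a\}$. A proper element $p\ne 1$ of $L$ with $t\nleq p$ for all $t\in S$ is $S$-prime if there is $s\in S$ such that for all $a,b\in L$, $a\cdot b\le p$ implies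 $s\cdot a\le p$ or $s\cdot b\le p$. $\mathrm{Spec}_S(L)$ is the set of $S$-prime elements. A family $\mathscr{F}\subseteq L$ with $S\subseteq\mathscr{F}$ is an $S$-Ako family if for all $s\in S$ and all $i,a,b\in L$: $i\vee(s\cdot a)\in\mathscr{F}$ and $i\vee(s\cdot b)\in\mathscr{F}$ imply $i\vee(a\cdot b)\in\mathscr{F}$. A family $\mathscr{F}\subseteq L$ with $S\subseteq\mathscr{F}$ is an $S$-Oka family if for all $s\in S$ and all $i,a\in L$: $i\vee(s\cdot a)\in\mathscr{F}$ and $(i:(s\cdot a))\in\mathscr{F}$ imply $i\in\mathscr{F}$. *)

(* Defs.v *)
From HB Require Import structures.
From mathcomp Require Import all_boot all_order.
From mathcomp Require Import boolp classical_sets functions cardinality.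
Set Implicit Arguments.
Unset Strict Implicit.
Unset Printing Implicit Defensive.
Local Open Scope classical_set_scope.
Local Open Scope order_scope.

HB.mixin Record isCompleteLattice d (L : Type) of Order.TBLattice d L := {
  supremums_neq0 : forall A : set L, supremums A !=set0;
  infimums_neq0 : forall A : set L, infimums A !=set0
}.

#[short(type="completeLatticeType")]
HB.structure Definition CompleteLattice d :=
  { L of Order.TBLattice d L & isCompleteLattice d L }.

(* The default value \bot of [supremum] is returned on the empty set, where it
   is the least upper bound; elsewhere [supremums_neq0] ensures that the value
   is the least upper bound of [A]. *)
Definition bigjoin d (L : completeLatticeType d) (A : set L) : L :=
  supremum \bot A.

HB.mixin Record isVLattice d (L : Type) of CompleteLattice d L := {
  vmul : L -> L -> L;
  vmulC : commutative vmul;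
  vmulA : associative vmul;
  vmul_le2r : forall a b c : L, a <= b -> vmul a c <= vmul b c;
  vmul_le_meet : forall a b : L, vmul a b <= Order.meet a b;
  vmulx1 : forall a : L, vmul a \top = a
}.

#[short(type="vLatticeType")]
HB.structure Definition VLattice d :=
  { L of CompleteLattice d L & isVLattice d L }.

Notation "a *v b" := (vmul a b) (at level 40, left associativity).

Section VLatticeNotions.
Context {d : Order.disp_t} {L : vLatticeType d}.
Implicit Types (a b c i m p s t x : L) (S F A : set L).

Definition compact_element c : Prop :=
  forall (I : Type) (a : I -> L), c <= bigjoin (range a) ->
  exists I0 : set I, finite_set I0 /\ c <= bigjoin (a @` I0).

Definition mult_closed S : Prop :=
  [/\ S !=set0,
      forall s, S s -> compact_element s
    & forall s1 s2, S s1 -> S s2 -> S (s1 *v s2)].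

Definition residual a b : L := bigjoin [set x | x *v b <= a].

Definition S_prime S p : Prop :=
  [/\ p != \top,
      forall t, S t -> ~~ (t <= p)
    & exists s, S s /\
        forall a b, a *v b <= p -> s *v a <= p \/ s *v b <= p].

Definition Spec S : set L := [set p | S_prime S p].

Definition S_Ako S F : Prop :=
  (S `<=` F)%classic /\
  forall s i a b, S s ->
    F (Order.join i (s *v a)) -> F (Order.join i (s *v b)) ->
    F (Order.join i (a *v b)).

Definition S_Oka S F : Prop :=
  (S `<=` F)%classic /\
  forall s i a, S s ->
    F (Order.join i (s *v a)) -> F (residual i (s *v a)) -> F i.

Definition Max A : set L :=
  [set m | A m /\ forall x, A x -> m <= x -> x = m].

End VLatticeNotions.

(* Main.v *)
(* Taking s = 1, which lies in S, a maximal element m of the complement of F is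
   even prime. If a, b are not below m and a * b <= m, every element strictly
   above m lies in F; so m \/ a and m \/ b lie in F, and so does (m : a), which
   is above both m and b. Either closure property then puts m in F. *)
Require Import Defs.
From mathcomp Require Import all_boot all_order.
From mathcomp Require Import boolp classical_sets.
Import Order.TTheory.
Local Open Scope classical_set_scope.
Local Open Scope order_scope.

(** The default [\bot] occurs only if [A] is empty or has no least upper bound; [x] rules out the
    first, [supremums_neq0] the second. *)
Lemma bigjoin_ub {d : Order.disp_t} {L : completeLatticeType d} {A : set L}
  {x : L} : A x -> x <= bigjoin A.
Proof.
move=> Ax; rewrite /bigjoin /supremum; case: ifPn => [/eqP A0|_].
  by move: Ax; rewrite A0.
case: xgetP => [y _ [ub _]|no_sup]; first exact: ub.
by have [y /no_sup] := supremums_neq0 A.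
Qed.

Section VLatticeTheory.
Context {d : Order.disp_t} {L : vLatticeType d}.
Implicit Types (a b m x : L) (F : set L).

Lemma vmul1x a : \top *v a = a.
Proof. by rewrite vmulC vmulx1. Qed.

Lemma vmul_lel a b : a *v b <= a.
Proof. exact: le_trans (vmul_le_meet a b) (leIl a b). Qed.

(** The converse can fail, since [*v] need not distribute over joins. *)
Lemma le_residual {x a b} : x *v b <= a -> x <= residual a b.
Proof. by move=> xb_le_a; apply: bigjoin_ub. Qed.

(** Outside [F], such an [x] would equal [m] by maximality. *)
Lemma Max_setC_gt {F m x} : Max (~` F)%classic m -> m <= x -> ~~ (x <= m) -> F x.
Proof.
move=> [_ m_max] m_le_x x_nle_m; apply: contrapT => /m_max /(_ m_le_x) xm.
by rewrite xm lexx in x_nle_m.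
Qed.

End VLatticeTheory.

Theorem theorem3p8 (d : Order.disp_t) (L : vLatticeType d) (S F : set L)
    (top_compact : compact_element (\top : L))
    (S_mult : mult_closed S) (S_top : S \top) (S_bot : ~ S \bot)
    (F_Ako_or_Oka : S_Ako S F \/ S_Oka S F)
    (F_max : forall m : L, Max (~` F)%classic m ->
      forall t : L, S t -> ~~ (t <= m)) :
  (Max (~` F) `<=` Spec S)%classic.
Proof.
move=> m m_max; have [nFm _] := m_max.
split; [|exact: F_max|].
  (* If [m] were [\top], the element [\top] of [S] would lie below it. *)
  by apply/eqP => m1; have := F_max m m_max _ S_top; rewrite m1 lexx.
exists \top; split=> // a b ab_le_m; rewrite !vmul1x.
have [|a_nle_m] := boolP (a <= m); first by left.
have [|b_nle_m] := boolP (b <= m); first by right.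
have F_join x : ~~ (x <= m) -> F (Order.join m x).
  move=> x_nle_m; apply: (Max_setC_gt m_max); first exact: leUl.
  by rewrite leUx lexx.
case: nFm; case: F_Ako_or_Oka => [[_ ako]|[_ oka]].
  (* As [a *v b <= m], [m] is its own join with [a *v b], the form of the Ako conclusion. *)
  rewrite -(join_idPr ab_le_m) joinC.
  by apply: (ako \top) => //; rewrite vmul1x; exact: F_join.
apply: (oka \top m a) => //; rewrite vmul1x; first exact: F_join.
apply: (Max_setC_gt m_max); first exact/le_residual/vmul_lel.
(* If [(m : a) <= m], then [b <= (m : a) <= m]. *)
by apply: contra b_nle_m; apply: le_trans; apply: le_residual; rewrite vmulC.
Qed.
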